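(* Let $A$ be a commutative ring, $I$ an ideal in $A$, let $\mathrm{Qcoh}(X)$ and $\mathrm{Qcoh}(Y)$ consist of symmetric bimodules over $A/I$ and $A$, respectively, and let $f:X\to Y$ be such that $f_*$ is the restriction of scalars from $A/I$ to $A$. Then for every $\mathcal{G}\in\mathrm{Qcoh}(Y)$ one has $\mathcal{G}^f=\hat{\mathcal{G}}_I$, the $I$-adic completion $\varprojlim_p\mathcal{G}/I^p\mathcal{G}$.
   Context: For a morphism $f:X\to Y$ given by an adjoint pair $f^*\dashv f_*$ between abelian categories $\mathrm{Qcoh}(Y)$, $\mathrm{Qcoh}(X)$ (with $\mathrm{Qcoh}(Y)$ complete) and $\mathcal{G}\in\mathrm{Qcoh}(Y)$, define inductively a decreasing filtration of $\mathcal{G}$: $\mathcal{G}^0:=\mathcal{G}$ and $\mathcal{G}^{p+1}:=\ker(\mathcal{G}^p\to f_*f^*\mathcal{G}^p)$, the arrow being the unit of the adjunction. Put $\mathcal{G}_p:=\mathrm{coker}(\mathcal{G}^{p+1}\to\mathcal{G})$ and $\mathcal{G}^f:=\lim_p\mathcal{G}_p$. *)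

(* Defs.v *)
From HB Require Import structures.
From mathcomp Require Import all_boot all_algebra.
From mathcomp Require Import generic_quotient ring_quotient.
From mathcomp Require Import boolp.

Set Implicit Arguments.
Unset Strict Implicit.
Unset Printing Implicit Defensive.

Import GRing.Theory.
Local Open Scope ring_scope.

Declare Scope cat_scope.
Delimit Scope cat_scope with cat.

Record category := Category {
  obj :> Type;
  hom : obj -> obj -> Type;
  idm : forall X, hom X X;
  comp : forall X Y Z, hom Y Z -> hom X Y -> hom X Z;
  comp1m : forall X Y (f : hom X Y), comp (idm Y) f = f;
  compm1 : forall X Y (f : hom X Y), comp f (idm X) = f;
  compA : forall X Y Z W (h : hom Z W) (g : hom Y Z) (f : hom X Y),
    comp h (comp g f) = comp (comp h g) f
}.

Arguments hom {c} X Y.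
Arguments idm {c} X.

Notation "g \c f" := (comp g f) (at level 50, left associativity) : cat_scope.
Local Open Scope cat_scope.

Record functor (C D : category) := Functor {
  fobj :> C -> D;
  fmap : forall X Y : C, hom X Y -> hom (fobj X) (fobj Y);
  fmap1 : forall X : C, fmap (idm X) = idm (fobj X);
  fmapM : forall (X Y Z : C) (g : hom Y Z) (f : hom X Y),
    fmap (g \c f) = fmap g \c fmap f
}.

Record adjunction (D C : category) (L : functor D C) (R : functor C D) :=
  Adjunction {
  adj_unit : forall X : D, hom X (R (L X));
  adj_counit : forall X : C, hom (L (R X)) X;
  adj_unit_nat : forall (X Y : D) (f : hom X Y),
    fmap R (fmap L f) \c adj_unit X = adj_unit Y \c f;
  adj_counit_nat : forall (X Y : C) (f : hom X Y),
    f \c adj_counit X = adj_counit Y \c fmap L (fmap R f);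
  adj_triangleL : forall X : D,
    adj_counit (L X) \c fmap L (adj_unit X) = idm (L X);
  adj_triangleR : forall X : C,
    fmap R (adj_counit X) \c adj_unit (R X) = idm (R X)
}.

Section Universal.
Variable C : category.
Implicit Types X Y Z K Q : C.

Definition is_iso X Y (f : hom X Y) : Prop :=
  exists g : hom Y X, g \c f = idm X /\ f \c g = idm Y.

Definition monic X Y (f : hom X Y) : Prop :=
  forall Z (g h : hom Z X), f \c g = f \c h -> g = h.

Definition epic X Y (f : hom X Y) : Prop :=
  forall Z (g h : hom Y Z), g \c f = h \c f -> g = h.

Definition is_initial X : Prop := forall Y, exists! _ : hom X Y, True.

Definition is_terminal X : Prop := forall Y, exists! _ : hom Y X, True.

Definition is_zero_object X : Prop := is_initial X /\ is_terminal X.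

Definition is_zero_hom X Y (f : hom X Y) : Prop :=
  exists Z (g : hom Z Y) (h : hom X Z), is_zero_object Z /\ f = g \c h.

Definition is_kernel X Y (f : hom X Y) K (k : hom K X) : Prop :=
  is_zero_hom (f \c k) /\
  forall Z (g : hom Z X), is_zero_hom (f \c g) -> exists! u, k \c u = g.

Definition is_cokernel X Y (f : hom X Y) Q (q : hom Y Q) : Prop :=
  is_zero_hom (q \c f) /\
  forall Z (g : hom Y Z), is_zero_hom (g \c f) -> exists! u, u \c q = g.

Definition is_product X Y Z (p : hom Z X) (q : hom Z Y) : Prop :=
  forall W (f : hom W X) (g : hom W Y), exists! u, p \c u = f /\ q \c u = g.

Definition is_coproduct X Y Z (i : hom X Z) (j : hom Y Z) : Prop :=
  forall W (f : hom X W) (g : hom Y W), exists! u, u \c i = f /\ u \c j = g.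

(* Diagrams are indexed by quivers. Since a diagram on a quiver is a functor on
   its free category, having all limits of this kind amounts to having all
   small limits. *)
Definition is_cone (V : Type) (E : V -> V -> Type) (D : V -> C)
    (d : forall i j, E i j -> hom (D i) (D j))
    L (l : forall i, hom L (D i)) : Prop :=
  forall i j (e : E i j), d i j e \c l i = l j.

Definition is_limit (V : Type) (E : V -> V -> Type) (D : V -> C)
    (d : forall i j, E i j -> hom (D i) (D j))
    L (l : forall i, hom L (D i)) : Prop :=
  is_cone d l /\
  forall Z (g : forall i, hom Z (D i)), is_cone d g ->
    exists! u : hom Z L, forall i, l i \c u = g i.

(* Freyd's axioms; the additive structure on the sets of morphisms is not part
   of the data, as these properties determine it. *)
Record abelian : Prop := Abelian {
  abelian_zero : exists X, is_zero_object X;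
  abelian_product : forall X Y,
    exists Z (p : hom Z X) (q : hom Z Y), is_product p q;
  abelian_coproduct : forall X Y,
    exists Z (i : hom X Z) (j : hom Y Z), is_coproduct i j;
  abelian_kernel : forall X Y (f : hom X Y),
    exists k : {K & hom K X}, is_kernel f (projT2 k);
  abelian_cokernel : forall X Y (f : hom X Y),
    exists q : {Q & hom Y Q}, is_cokernel f (projT2 q);
  abelian_normal : forall X Y (f : hom X Y), monic f ->
    exists Z (g : hom Y Z), is_kernel g f;
  abelian_conormal : forall X Y (f : hom X Y), epic f ->
    exists Z (g : hom Z X), is_cokernel g f
}.

Definition complete : Prop :=
  forall (V : Type) (E : V -> V -> Type) (D : V -> C)
    (d : forall i j, E i j -> hom (D i) (D j)),
  exists l : {L & forall i, hom L (D i)}, is_limit d (projT2 l).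

End Universal.

Record abelianCategory := AbelianCategory {
  abcat :> category;
  abcat_abelian : abelian abcat
}.

Section Chosen.
Variable C : abelianCategory.

Section KerCoker.
Variables (X Y : C) (f : hom X Y).

Let kerD := cid (abelian_kernel (abcat_abelian C) f).
Definition ker_obj : C := projT1 (projT1 kerD).
Definition ker : hom ker_obj X := projT2 (projT1 kerD).
Lemma kerP : is_kernel f ker. Proof. exact: projT2 kerD. Qed.

Let cokerD := cid (abelian_cokernel (abcat_abelian C) f).
Definition coker_obj : C := projT1 (projT1 cokerD).
Definition coker : hom Y coker_obj := projT2 (projT1 cokerD).
Lemma cokerP : is_cokernel f coker. Proof. exact: projT2 cokerD. Qed.

End KerCoker.

Lemma is_zero_hom_precomp (X Y Z : C) (f : hom Y Z) (g : hom X Y) :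
  is_zero_hom f -> is_zero_hom (f \c g).
Proof. by case=> O [a [b [O0 ->]]]; exists O, a, (b \c g); rewrite compA. Qed.

Lemma coker_factor (W X Y : C) (f : hom X Y) (s : hom W X) :
  exists u : hom (coker_obj (f \c s)) (coker_obj f),
    u \c coker (f \c s) = coker f.
Proof.
have [_ univ] := cokerP (f \c s).
have [|u [uP _]] := univ _ (coker f); last by exists u.
by rewrite compA; apply: is_zero_hom_precomp; case: (cokerP f).
Qed.

Definition coker_map (W X Y : C) (f : hom X Y) (s : hom W X) :
    hom (coker_obj (f \c s)) (coker_obj f) :=
  projT1 (cid (coker_factor f s)).

Lemma coker_mapE (W X Y : C) (f : hom X Y) (s : hom W X) :
  coker_map f s \c coker (f \c s) = coker f.
Proof. exact: projT2 (cid (coker_factor f s)). Qed.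

End Chosen.

Inductive succ_edge : nat -> nat -> Type := SuccEdge n : succ_edge n.+1 n.

Record tower (C : category) := Tower {
  tower_obj :> nat -> C;
  tower_step : forall n, hom (tower_obj n.+1) (tower_obj n)
}.

Definition tower_map (C : category) (T : tower C) (i j : nat)
    (e : succ_edge i j) : hom (T i) (T j) :=
  match e in succ_edge i j return hom (T i) (T j) with
  | SuccEdge n => tower_step T n
  end.

Section TowerLimit.
Variables (C : category) (C_complete : complete C) (T : tower C).

Let limD := cid (C_complete (tower_map T)).
Definition tower_lim : C := projT1 (projT1 limD).
Definition tower_proj : forall p, hom tower_lim (T p) := projT2 (projT1 limD).
Lemma tower_limP : is_limit (tower_map T) tower_proj.
Proof. exact: projT2 limD. Qed.

End TowerLimit.

(* A morphism f : X -> Y of spaces; the arguments X and Y stand for the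
   categories Qcoh(X) and Qcoh(Y). *)
Record morphism (X Y : abelianCategory) := Morphism {
  inverse_image : functor Y X;
  direct_image : functor X Y;
  morphism_adj : adjunction inverse_image direct_image
}.

Section Completion.
Variables (X Y : abelianCategory) (f : morphism X Y) (G : Y).

Definition unit_at (H : Y) := adj_unit (morphism_adj f) H.

Fixpoint filt (p : nat) : Y :=
  if p is q.+1 then ker_obj (unit_at (filt q)) else G.

Definition filt_step (p : nat) : hom (filt p.+1) (filt p) :=
  ker (unit_at (filt p)).

Fixpoint filt_incl (p : nat) : hom (filt p) G :=
  match p return hom (filt p) G with
  | 0 => idm G
  | q.+1 => filt_incl q \c filt_step q
  end.

(* G_p is G / G^(p+1), not G / G^p: the tower starts with G_0 = G / G^1. *)
Definition filt_quot (p : nat) : Y := coker_obj (filt_incl p.+1).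

Definition filt_tower : tower Y :=
  Tower (tower_obj := filt_quot)
    (fun p => coker_map (filt_incl p.+1) (filt_step p.+1)).

Definition completion (Y_complete : complete Y) : Y :=
  tower_lim Y_complete filt_tower.

Definition completion_proj (Y_complete : complete Y) (p : nat) :
    hom (completion Y_complete) (filt_quot p) :=
  tower_proj Y_complete filt_tower p.

End Completion.

Record submodule (R : pzRingType) (V : lmodType R) := Submodule {
  smem :> V -> Prop;
  smem0 : smem 0;
  smem_lin : forall (a : R) u v, smem u -> smem v -> smem (a *: u + v)
}.

Section SubmoduleTheory.
Variables (R : pzRingType) (V : lmodType R) (S : submodule V).

Definition smemb : {pred V} := fun v => `[< S v >].

Lemma smembE v : (v \in smemb) = `[< S v >]. Proof. by []. Qed.

Fact smemb_closed : submod_closed smemb.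
Proof.
split=> [|a u v]; rewrite !smembE; first exact/asboolP/smem0.
by move=> /asboolP Su /asboolP Sv; apply/asboolP/smem_lin.
Qed.

HB.instance Definition _ := GRing.isSubmodClosed.Build R V smemb smemb_closed.

Definition subm : Type := {v : V | v \in smemb}.
HB.instance Definition _ := SubChoice.on subm.
HB.instance Definition _ := [SubChoice_isSubLmodule of subm by <:].

Definition quotm : Type := Quotient.quot smemb.
HB.instance Definition _ := GRing.Zmodule.on quotm.
HB.instance Definition _ := EqQuotient.on quotm.

Definition quotm_pi (v : V) : quotm := (\pi_quotm v)%qT.

Lemma quotm_piP u v : quotm_pi u = quotm_pi v <-> S (u - v).
Proof.
split=> [/eqP|Suv]; last apply/eqP; rewrite -Quotient.idealrBE.
  by rewrite smembE => /asboolP.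
by rewrite smembE; apply/asboolP.
Qed.

Lemma quotm_reprK (x : quotm) : quotm_pi (repr x) = x.
Proof. exact: reprK. Qed.

Lemma quotm_piD u v : quotm_pi (u + v) = quotm_pi u + quotm_pi v.
Proof. exact: Quotient.pi_add. Qed.

Definition quotm_scale (a : R) (x : quotm) : quotm := quotm_pi (a *: repr x).

Lemma quotm_scaleE a v : quotm_scale a (quotm_pi v) = quotm_pi (a *: v).
Proof.
apply/quotm_piP; rewrite -scalerBr -[_ *: _]addr0.
by apply: smem_lin; [apply/quotm_piP; rewrite quotm_reprK|exact: smem0].
Qed.

Fact quotm_scaleA a b x :
  quotm_scale a (quotm_scale b x) = quotm_scale (a * b) x.
Proof. by rewrite -[x]quotm_reprK !quotm_scaleE scalerA. Qed.

Fact quotm_scale1 : left_id 1 quotm_scale.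
Proof. by move=> x; rewrite -[x]quotm_reprK quotm_scaleE scale1r. Qed.

Fact quotm_scaleDr : right_distributive quotm_scale +%R.
Proof.
move=> a x y; rewrite -[x]quotm_reprK -[y]quotm_reprK.
by rewrite -quotm_piD !quotm_scaleE scalerDr quotm_piD.
Qed.

Fact quotm_scaleDl x : {morph quotm_scale^~ x : a b / a + b}.
Proof.
move=> a b; rewrite -[x]quotm_reprK.
by rewrite !quotm_scaleE scalerDl quotm_piD.
Qed.

HB.instance Definition _ := GRing.Zmodule_isLmodule.Build R quotm
  quotm_scaleA quotm_scale1 quotm_scaleDr quotm_scaleDl.

Lemma quotm_pi_linear : linear quotm_pi.
Proof. by move=> a u v; rewrite quotm_piD -quotm_scaleE. Qed.

End SubmoduleTheory.

Definition ideal (A : comPzRingType) := submodule A^o.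

Section QuotientRing.
Variables (A : comPzRingType) (I : ideal A).

(* Unlike {ideal_quot I}, this covers the unit ideal; A / I may be trivial. *)
Definition quotr := quotm I.
HB.instance Definition _ := GRing.Zmodule.on quotr.

Definition quotr_pi (a : A) : quotr := quotm_pi I (a : A^o).
Definition quotr_one : quotr := quotr_pi 1.
Definition quotr_mul (x y : quotr) : quotr :=
  quotr_pi ((repr x : A) * (repr y : A)).

Lemma quotr_reprK (x : quotr) : quotr_pi (repr x) = x.
Proof. exact: quotm_reprK. Qed.

Lemma quotr_mulE a b : quotr_mul (quotr_pi a) (quotr_pi b) = quotr_pi (a * b).
Proof.
have piZ c (x : quotr) : quotr_pi (c * (repr x : A)) = (c : A) *: (x : quotm I).
  by [].
have piZE c d : (c : A) *: (quotr_pi d : quotm I) = quotr_pi (c * d).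
  exact: (quotm_scaleE I c (d : A^o)).
by rewrite /quotr_mul piZ piZE mulrC piZ piZE mulrC.
Qed.

Fact quotr_mulA : associative quotr_mul.
Proof.
move=> x y z; rewrite -[x]quotr_reprK -[y]quotr_reprK -[z]quotr_reprK.
by rewrite !quotr_mulE mulrA.
Qed.

Fact quotr_mulC : commutative quotr_mul.
Proof.
move=> x y; rewrite -[x]quotr_reprK -[y]quotr_reprK.
by rewrite !quotr_mulE mulrC.
Qed.

Fact quotr_mul1 : left_id quotr_one quotr_mul.
Proof. by move=> x; rewrite -[x]quotr_reprK quotr_mulE mul1r. Qed.

Fact quotr_mulDl : left_distributive quotr_mul +%R.
Proof.
move=> x y z; rewrite -[x]quotr_reprK -[y]quotr_reprK -[z]quotr_reprK.
rewrite -[_ (repr x) + _](quotm_piD I) !quotr_mulE mulrDl.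
exact: quotm_piD.
Qed.

HB.instance Definition _ := GRing.Zmodule_isComPzRing.Build quotr
  quotr_mulA quotr_mulC quotr_mul1 quotr_mulDl.

Fact quotr_pi_additive : zmod_morphism quotr_pi.
Proof.
move=> a b; apply/eqP; rewrite eq_sym subr_eq; apply/eqP.
by rewrite -[LHS](congr1 quotr_pi (subrK b a)); apply: quotm_piD.
Qed.

Fact quotr_pi_multiplicative : monoid_morphism quotr_pi.
Proof. by split=> // a b; rewrite -quotr_mulE. Qed.

HB.instance Definition _ :=
  GRing.isZmodMorphism.Build A quotr quotr_pi quotr_pi_additive.
HB.instance Definition _ :=
  GRing.isMonoidMorphism.Build A quotr quotr_pi quotr_pi_multiplicative.

End QuotientRing.

Section IdealProduct.
Variables (A : comPzRingType) (V : lmodType A).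

Definition full_submodule : submodule V :=
  @Submodule A V (fun=> True) Logic.I (fun _ _ _ _ _ => Logic.I).

Section Product.
Variables (J : ideal A) (N : submodule V).

Definition iprod_set (v : V) : Prop :=
  exists2 s : seq (A * V), (forall x, x \in s -> J x.1 /\ N x.2) &
    v = \sum_(x <- s) x.1 *: x.2.

Fact iprod_set0 : iprod_set 0.
Proof. by exists [::] => //; rewrite big_nil. Qed.

Fact iprod_set_lin (a : A) u v :
  iprod_set u -> iprod_set v -> iprod_set (a *: u + v).
Proof.
move=> [s sP ->] [t tP ->].
exists ([seq (a * x.1, x.2) | x <- s] ++ t) => [x|].
  rewrite mem_cat => /orP[/mapP[y ys ->]|/tP//]; have [Jy Ny] := sP y ys.
  split=> //=; rewrite -[_ * _]addr0.
  exact: (smem_lin (s := J) a Jy (smem0 J)).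
rewrite big_cat big_map scaler_sumr; congr (_ + _).
by apply: eq_bigr => x _; rewrite scalerA.
Qed.

Definition iprod : submodule V := Submodule iprod_set0 iprod_set_lin.

End Product.
End IdealProduct.

Fixpoint ideal_pow (A : comPzRingType) (I : ideal A) (p : nat) : ideal A :=
  if p is q.+1 then iprod I (ideal_pow I q) else full_submodule A^o.

Lemma ideal_powS_sub (A : comPzRingType) (I : ideal A) p :
  forall a, ideal_pow I p.+1 a -> ideal_pow I p a.
Proof.
move=> _ [s sP ->]; elim: s sP => [|x s IH] sP.
  by rewrite big_nil; apply: smem0.
rewrite big_cons; apply: smem_lin; first by have [] := sP x (mem_head _ _).
by apply: IH => y ys; apply: sP; rewrite inE ys orbT.
Qed.

Record bimodule (A : pzRingType) := Bimodule {
  bimod_left :> lmodType A;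
  ract : bimod_left -> A -> bimod_left;
  ractA : forall v a b, ract (ract v a) b = ract v (a * b);
  ract1 : forall v, ract v 1 = v;
  ractDl : forall u v a, ract (u + v) a = ract u a + ract v a;
  ractDr : forall v a b, ract v (a + b) = ract v a + ract v b;
  ract_scale : forall a v b, ract (a *: v) b = a *: ract v b
}.

Record symBimodule (A : pzRingType) := SymBimodule {
  sym_bimod :> bimodule A;
  sym_ract : forall (a : A) (v : sym_bimod), ract v a = a *: v
}.

Record bimod_hom (A : pzRingType) (M N : bimodule A) := BimodHom {
  bimod_fun :> M -> N;
  bimod_hom_linear : linear bimod_fun;
  bimod_hom_ract : forall v a, bimod_fun (ract v a) = ract (bimod_fun v) a
}.

Lemma bimod_homP (A : pzRingType) (M N : bimodule A) (f g : bimod_hom M N) :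
  (forall v, f v = g v) -> f = g.
Proof.
case: f g => f fl fr [g gl gr] /= /funext fg; rewrite {}fg in fl fr *.
by congr BimodHom; apply: Prop_irrelevance.
Qed.

Section BimodCat.
Variable A : pzRingType.

Definition bimod_id (M : bimodule A) : bimod_hom M M :=
  @BimodHom A M M id (fun _ _ _ => erefl) (fun _ _ => erefl).

Section Comp.
Variables (M N P : bimodule A) (g : bimod_hom N P) (f : bimod_hom M N).

Fact bimod_comp_linear : linear (g \o f).
Proof. by move=> a u v /=; rewrite !bimod_hom_linear. Qed.

Fact bimod_comp_ract v a : (g \o f) (ract v a) = ract ((g \o f) v) a.
Proof. by rewrite /= !bimod_hom_ract. Qed.

Definition bimod_comp : bimod_hom M P :=
  BimodHom bimod_comp_linear bimod_comp_ract.

End Comp.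

Fact bimod_comp1m (M N : bimodule A) (f : bimod_hom M N) :
  bimod_comp (bimod_id N) f = f.
Proof. exact: bimod_homP. Qed.

Fact bimod_compm1 (M N : bimodule A) (f : bimod_hom M N) :
  bimod_comp f (bimod_id M) = f.
Proof. exact: bimod_homP. Qed.

Fact bimod_compA (M N P Q : bimodule A) (h : bimod_hom P Q) (g : bimod_hom N P)
    (f : bimod_hom M N) :
  bimod_comp h (bimod_comp g f) = bimod_comp (bimod_comp h g) f.
Proof. exact: bimod_homP. Qed.

Definition symBimod_cat : category :=
  @Category (symBimodule A) (fun M N => bimod_hom M N) (fun M => bimod_id M)
    (fun M N P => @bimod_comp M N P) (fun M N f => bimod_comp1m f)
    (fun M N f => bimod_compm1 f) (fun M N P Q h g f => bimod_compA h g f).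

End BimodCat.

Section SymBimodTheory.
Variable A : comPzRingType.

Fact lmod_ractA (V : lmodType A) (v : V) (a b : A) :
  b *: (a *: v) = (a * b) *: v.
Proof. by rewrite scalerA mulrC. Qed.

Fact lmod_ract_scale (V : lmodType A) (a : A) (v : V) (b : A) :
  b *: (a *: v) = a *: (b *: v).
Proof. by rewrite !scalerA mulrC. Qed.

Definition lmod_bimodule (V : lmodType A) : bimodule A :=
  @Bimodule A V (fun v a => a *: v) (@lmod_ractA V) (@scale1r A V)
    (fun u v a => scalerDr a u v) (fun v a b => scalerDl v a b)
    (@lmod_ract_scale V).

Definition sym_of_lmod (V : lmodType A) : symBimodule A :=
  @SymBimodule A (lmod_bimodule V) (fun _ _ => erefl).

Section SymHom.
Variables (M N : symBimodule A) (f : M -> N) (f_lin : linear f).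

Fact sym_hom_ract v a : f (ract v a) = ract (f v) a.
Proof.
have f0 : f 0 = 0.
  by have := f_lin (-1) 0 0; rewrite scaleN1r addr0 oppr0 scaleN1r addNr.
by rewrite !sym_ract -[a *: v]addr0 f_lin f0 addr0.
Qed.

Definition sym_hom : @hom (symBimod_cat A) M N := BimodHom f_lin sym_hom_ract.

End SymHom.

End SymBimodTheory.

Section Products.
Variables (A : pzRingType) (V : Type) (D : V -> lmodType A).

Definition dprod : Type := forall i, D i.
HB.instance Definition _ := gen_eqMixin dprod.
HB.instance Definition _ := gen_choiceMixin dprod.

Let add (x y : dprod) : dprod := fun i => x i + y i.
Let opp (x : dprod) : dprod := fun i => - x i.
Let zero : dprod := fun i => 0.
Let scale (a : A) (x : dprod) : dprod := fun i => a *: x i.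

Fact dprod_addA : associative add.
Proof. by move=> x y z; apply: functional_extensionality_dep => i; apply: addrA. Qed.
Fact dprod_addC : commutative add.
Proof. by move=> x y; apply: functional_extensionality_dep => i; apply: addrC. Qed.
Fact dprod_add0 : left_id zero add.
Proof. by move=> x; apply: functional_extensionality_dep => i; apply: add0r. Qed.
Fact dprod_addN : left_inverse zero opp add.
Proof. by move=> x; apply: functional_extensionality_dep => i; apply: addNr. Qed.

HB.instance Definition _ :=
  GRing.isZmodule.Build dprod dprod_addA dprod_addC dprod_add0 dprod_addN.

Fact dprod_scaleA a b x : scale a (scale b x) = scale (a * b) x.
Proof. by apply: functional_extensionality_dep => i; apply: scalerA. Qed.
Fact dprod_scale1 : left_id 1 scale.
Proof. by move=> x; apply: functional_extensionality_dep => i; apply: scale1r. Qed.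
Fact dprod_scaleDr : right_distributive scale +%R.
Proof. by move=> a x y; apply: functional_extensionality_dep => i; apply: scalerDr. Qed.
Fact dprod_scaleDl x : {morph scale^~ x : a b / a + b}.
Proof. by move=> a b; apply: functional_extensionality_dep => i; apply: scalerDl. Qed.

HB.instance Definition _ := GRing.Zmodule_isLmodule.Build A dprod
  dprod_scaleA dprod_scale1 dprod_scaleDr dprod_scaleDl.

End Products.

Section SymBimodAbelian.
Variable A : comPzRingType.
Local Notation C := (symBimod_cat A).
Implicit Types M N P K : C.

Lemma bimod_hom0 M N (f : hom M N) : f 0 = 0.
Proof.
have := bimod_hom_linear f (-1) 0 0.
by rewrite scaleN1r addr0 oppr0 scaleN1r addNr.
Qed.

Lemma bimod_homB M N (f : hom M N) u v : f (u - v) = f u - f v.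
Proof. by rewrite addrC -scaleN1r bimod_hom_linear scaleN1r addrC. Qed.

Lemma zero_hom_linear M N : linear (fun _ : M => 0 : N).
Proof. by move=> a u v; rewrite scaler0 addr0. Qed.

Definition zero_bimod : C := sym_of_lmod 'rV[A]_0.

Lemma zero_bimodP : is_zero_object zero_bimod.
Proof.
split=> M.
  exists (sym_hom (@zero_hom_linear zero_bimod M)); split=> // g _.
  apply: bimod_homP => v; have -> : v = 0 by apply: thinmx0.
  exact/esym/(bimod_hom0 g).
exists (sym_hom (@zero_hom_linear M zero_bimod)); split=> // g _.
by apply: bimod_homP => v; apply: esym; apply: thinmx0.
Qed.

Lemma is_zero_bimod_hom M N (f : hom M N) :
  is_zero_hom f <-> forall v, f v = 0.
Proof.
split=> [[Z [g [h [[_ Zt] ->]]]] v /=|f0].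
  have [z [_ z_uniq]] := Zt M.
  have -> : h = sym_hom (@zero_hom_linear M Z).
    by rewrite -(z_uniq h) // (z_uniq (sym_hom (@zero_hom_linear M Z))).
  exact: bimod_hom0.
exists zero_bimod, (sym_hom (@zero_hom_linear zero_bimod N)),
  (sym_hom (@zero_hom_linear M zero_bimod)).
by split; [exact: zero_bimodP|apply: bimod_homP].
Qed.

Section Kernel.
Variables (M N : C) (f : hom M N).

Fact ker_set_lin (a : A) u v : f u = 0 -> f v = 0 -> f (a *: u + v) = 0.
Proof. by move=> fu fv; rewrite bimod_hom_linear fu fv scaler0 addr0. Qed.

Definition ker_subm : submodule M :=
  @Submodule _ _ (fun v => f v = 0) (bimod_hom0 f) ker_set_lin.

Definition ker_bimod : C := sym_of_lmod (subm ker_subm).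

Fact ker_incl_linear : linear (fun v : ker_bimod => val v : M).
Proof. by []. Qed.

Definition ker_incl : hom ker_bimod M := sym_hom ker_incl_linear.

Lemma ker_inclP (v : ker_bimod) : f (ker_incl v) = 0.
Proof. exact/asboolP/(valP v). Qed.

Lemma ker_incl_surj u : f u = 0 -> exists v : ker_bimod, ker_incl v = u.
Proof. by move=> /asboolP fu; exists (exist _ u fu). Qed.

Fact im_set0 : exists u, f u = 0.
Proof. by exists 0; rewrite bimod_hom0. Qed.

Fact im_set_lin (a : A) u v : (exists x, f x = u) -> (exists x, f x = v) ->
  exists x, f x = a *: u + v.
Proof. by move=> [x <-] [y <-]; exists (a *: x + y); rewrite bimod_hom_linear. Qed.

Definition im_subm : submodule N :=
  @Submodule _ _ (fun v => exists u, f u = v) im_set0 im_set_lin.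

Definition coker_bimod : C := sym_of_lmod (quotm im_subm).

Definition coker_pi : hom N coker_bimod :=
  sym_hom (N := coker_bimod) (quotm_pi_linear im_subm).

Lemma coker_pi_eq0 v : coker_pi v = 0 <-> exists u, f u = v.
Proof.
rewrite -(bimod_hom0 coker_pi); split=> [/quotm_piP|]; rewrite ?subr0 //.
by move=> fv; apply/quotm_piP; rewrite subr0.
Qed.

Lemma coker_pi_surj (x : coker_bimod) : exists v, coker_pi v = x.
Proof. by exists (repr x); apply: quotm_reprK. Qed.

End Kernel.

Lemma inj_is_kernel M N P (f : hom M N) (k : hom P M) :
  injective k -> (forall v, f v = 0 <-> exists u, k u = v) -> is_kernel f k.
Proof.
move=> k_inj kP; split=> [|Z g /is_zero_bimod_hom fg0].
  by apply/is_zero_bimod_hom => v /=; apply/kP; exists v.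
pose u z := projT1 (cid ((kP (g z)).1 (fg0 z))).
have uE z : k (u z) = g z by rewrite /u; case: cid.
have u_lin : linear u.
  by move=> a x y; apply: k_inj; rewrite bimod_hom_linear !uE bimod_hom_linear.
exists (sym_hom u_lin); split=> [|w kw].
  by apply: bimod_homP => z; apply: uE.
by apply: bimod_homP => z /=; apply: k_inj; rewrite uE -kw.
Qed.

Lemma surj_is_cokernel M N P (f : hom M N) (q : hom N P) :
  (forall x, exists v, q v = x) -> (forall v, q v = 0 <-> exists u, f u = v) ->
  is_cokernel f q.
Proof.
move=> q_surj qP; split=> [|Z g /is_zero_bimod_hom gf0].
  by apply/is_zero_bimod_hom => v /=; apply/qP; exists v.
have gq v w : q v = q w -> g v = g w.
  move=> /eqP; rewrite -subr_eq0 -bimod_homB => /eqP/qP[u fu].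
  by apply/eqP; rewrite -subr_eq0 -bimod_homB -fu; apply/eqP/gf0.
pose u x := g (projT1 (cid (q_surj x))).
have uE v : u (q v) = g v by rewrite /u; case: cid => w /= /gq.
have u_lin : linear u.
  move=> a x y; have [v <-] := q_surj x; have [w <-] := q_surj y.
  by rewrite -bimod_hom_linear !uE bimod_hom_linear.
exists (sym_hom u_lin); split=> [|w wq].
  by apply: bimod_homP => v; apply: uE.
by apply: bimod_homP => x /=; have [v <-] := q_surj x; rewrite uE -wq.
Qed.

Lemma monic_inj M N (f : hom M N) : monic f -> injective f.
Proof.
move=> f_mono u v /eqP; rewrite -subr_eq0 -bimod_homB => /eqP fuv.
pose R := sym_of_lmod A^o : C.
have g_lin : linear (fun a : R => (a : A) *: (u - v) : M).
  by move=> a b c; rewrite scalerDl scalerA.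
have /f_mono/(congr1 (fun h : hom R M => h (1 : A))) /= :
    f \c sym_hom g_lin = f \c sym_hom (@zero_hom_linear R M).
  by apply: bimod_homP => a /=; rewrite bimod_hom0 -[_ *: _]addr0
    bimod_hom_linear fuv scaler0 add0r bimod_hom0.
by rewrite scale1r => /eqP; rewrite subr_eq0 => /eqP.
Qed.

Lemma epic_surj M N (f : hom M N) : epic f -> forall v, exists u, f u = v.
Proof.
move=> f_epi v; apply/coker_pi_eq0.
have -> // : coker_pi f = sym_hom (@zero_hom_linear N (coker_bimod f)).
by apply: f_epi; apply: bimod_homP => u /=; apply/coker_pi_eq0; exists u.
Qed.

Lemma symBimod_abelian : abelian C.
Proof.
split.
- by exists zero_bimod; apply: zero_bimodP.
- move=> M N; pose P := sym_of_lmod (M * N)%type : C.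
  have l1 : linear (fun x : P => x.1 : M) by [].
  have l2 : linear (fun x : P => x.2 : N) by [].
  exists P, (sym_hom l1), (sym_hom l2) => W f g.
  have l3 : linear (fun w : W => (f w, g w) : P).
    by move=> a u v; rewrite !bimod_hom_linear.
  exists (sym_hom l3); split=> [|u [uf ug]]; first by split; apply: bimod_homP.
  by apply: bimod_homP => w; rewrite [LHS]/= -uf -ug /=; case: (u w).
- move=> M N; pose P := sym_of_lmod (M * N)%type : C.
  have l1 : linear (fun x : M => (x, 0) : P).
    by move=> a u v; congr pair; rewrite /= scaler0 addr0.
  have l2 : linear (fun x : N => (0, x) : P).
    by move=> a u v; congr pair; rewrite /= scaler0 addr0.
  exists P, (sym_hom l1), (sym_hom l2) => W f g.
  have l3 : linear (fun x : P => f x.1 + g x.2 : W).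
    by move=> a u v; rewrite !bimod_hom_linear scalerDr addrACA.
  exists (sym_hom l3); split=> [|u [uf ug]].
    by split; apply: bimod_homP => x /=; rewrite bimod_hom0 ?addr0 ?add0r.
  apply: bimod_homP => -[x y]; rewrite [LHS]/= -uf -ug /=.
  rewrite -[u (x, 0)]scale1r -bimod_hom_linear scale1r; congr (u _).
  by congr pair; rewrite /= ?addr0 ?add0r.
- move=> M N f; exists (existT (fun K => hom K M) _ (ker_incl f)).
  apply: inj_is_kernel => [u v /val_inj //|v].
  by split=> [/ker_incl_surj//|[u <-]]; apply: ker_inclP.
- move=> M N f; exists (existT (fun Q => hom N Q) _ (coker_pi f)).
  exact: (surj_is_cokernel (coker_pi_surj (f := f)) (coker_pi_eq0 f)).
- move=> M N f /monic_inj f_inj; exists (coker_bimod f), (coker_pi f).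
  by apply: inj_is_kernel => // v; apply: coker_pi_eq0.
- move=> M N f /epic_surj f_surj; exists (ker_bimod f), (ker_incl f).
  apply: surj_is_cokernel => // v.
  by split=> [/ker_incl_surj//|[u <-]]; apply: ker_inclP.
Qed.

Lemma symBimod_complete : complete C.
Proof.
move=> V E D d; pose P := dprod (fun i => (D i : lmodType A)).
have S0 i j (e : E i j) : d i j e ((0 : P) i) = (0 : P) j.
  exact: bimod_hom0.
have Sl (a : A) (x y : P) :
    (forall i j (e : E i j), d i j e (x i) = x j) ->
    (forall i j (e : E i j), d i j e (y i) = y j) ->
    forall i j (e : E i j), d i j e ((a *: x + y) i) = (a *: x + y) j.
  by move=> xP yP i j e; rewrite [LHS]bimod_hom_linear xP yP.
pose S : submodule P := Submodule S0 Sl.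
pose L := sym_of_lmod (subm S) : C.
have l_lin i : linear (fun x : L => val x i : D i) by [].
exists (existT (fun L => forall i, hom L (D i)) L (fun i => sym_hom (l_lin i))).
split=> [i j e|Z g gP] /=.
  by apply: bimod_homP => x /=; have /asboolP := valP x; apply.
have uS z : (fun i => g i z) \in smemb S.
  by apply/asboolP => i j e; rewrite -(gP i j e).
have u_lin : linear (fun z : Z => exist _ (fun i => g i z) (uS z) : L).
  move=> a x y; apply: val_inj; apply: functional_extensionality_dep => i.
  exact: bimod_hom_linear.
exists (sym_hom u_lin); split=> [i|w wP]; first exact: bimod_homP.
apply: bimod_homP => z; apply: val_inj.
apply: functional_extensionality_dep => i.
exact: esym (congr1 (fun h : hom Z (D i) => h z) (wP i)).
Qed.

End SymBimodAbelian.

Definition symBimod (A : comPzRingType) : abelianCategory :=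
  AbelianCategory (symBimod_abelian A).

Section Restriction.
Variables (A B : comPzRingType) (phi : {rmorphism A -> B}).

Section Objects.
Variable N : symBimodule B.

Definition restr : Type := N.
HB.instance Definition _ := GRing.Zmodule.on restr.

Let scale (a : A) (v : restr) : restr := phi a *: (v : N).

Fact restr_scaleA a b v : scale a (scale b v) = scale (a * b) v.
Proof. by rewrite /scale scalerA rmorphM. Qed.
Fact restr_scale1 : left_id 1 scale.
Proof. by move=> v; rewrite /scale rmorph1 scale1r. Qed.
Fact restr_scaleDr : right_distributive scale +%R.
Proof. by move=> a u v; apply: scalerDr. Qed.
Fact restr_scaleDl v : {morph scale^~ v : a b / a + b}.
Proof. by move=> a b; rewrite /scale rmorphD scalerDl. Qed.

HB.instance Definition _ := GRing.Zmodule_isLmodule.Build A restr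
  restr_scaleA restr_scale1 restr_scaleDr restr_scaleDl.

Definition restr_ract (v : restr) (a : A) : restr := ract (v : N) (phi a).

Fact restr_ractA v a b : restr_ract (restr_ract v a) b = restr_ract v (a * b).
Proof. by rewrite /restr_ract ractA rmorphM. Qed.
Fact restr_ract1 v : restr_ract v 1 = v.
Proof. by rewrite /restr_ract rmorph1 ract1. Qed.
Fact restr_ractDl u v a :
  restr_ract (u + v) a = restr_ract u a + restr_ract v a.
Proof. exact: ractDl. Qed.
Fact restr_ractDr v a b :
  restr_ract v (a + b) = restr_ract v a + restr_ract v b.
Proof. by rewrite /restr_ract rmorphD ractDr. Qed.
Fact restr_ract_scale (a : A) v b :
  restr_ract (a *: v) b = a *: restr_ract v b.
Proof. exact: ract_scale. Qed.

Definition restr_bimod : symBimod A :=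
  @SymBimodule A
    (Bimodule restr_ractA restr_ract1 restr_ractDl restr_ractDr restr_ract_scale)
    (fun a v => sym_ract (phi a) v).

End Objects.

Definition restr_hom (M N : symBimod B) (f : hom M N) :
    hom (restr_bimod M) (restr_bimod N) :=
  @BimodHom A (restr_bimod M) (restr_bimod N) f
    (fun a u v => bimod_hom_linear f (phi a) u v)
    (fun v a => bimod_hom_ract f v (phi a)).

Fact restr_hom1 (M : symBimod B) : restr_hom (idm M) = idm (restr_bimod M).
Proof. exact: bimod_homP. Qed.

Fact restr_homM (M N P : symBimod B) (g : hom N P) (f : hom M N) :
  restr_hom (g \c f) = restr_hom g \c restr_hom f.
Proof. exact: bimod_homP. Qed.

Definition restriction_of_scalars : functor (symBimod B) (symBimod A) :=
  @Functor (symBimod B) (symBimod A) restr_bimod restr_hom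
    restr_hom1 restr_homM.

End Restriction.

Section AdicCompletion.
Variables (A : comPzRingType) (I : ideal A) (G : symBimod A).

Definition adic_subm (p : nat) : submodule G :=
  iprod (ideal_pow I p) (full_submodule G).

Definition adic_quot (p : nat) : symBimod A := sym_of_lmod (quotm (adic_subm p)).

Definition adic_pi (p : nat) : hom G (adic_quot p) :=
  sym_hom (N := adic_quot p) (quotm_pi_linear (adic_subm p)).

Definition adic_step_fun (p : nat) (x : adic_quot p.+1) : adic_quot p :=
  quotm_pi (adic_subm p) (repr (x : quotm (adic_subm p.+1))).

Lemma adic_stepE p v : adic_step_fun (adic_pi p.+1 v) = adic_pi p v.
Proof.
apply/quotm_piP.
have [s sP ->] : adic_subm p.+1 (repr (quotm_pi (adic_subm p.+1) v) - v).
  by apply/quotm_piP; apply: quotm_reprK.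
by exists s => // x /sP[/ideal_powS_sub].
Qed.

Fact adic_step_linear p : linear (@adic_step_fun p).
Proof.
have pi_surj q (x : adic_quot q) : exists v, adic_pi q v = x.
  by exists (repr (x : quotm (adic_subm q))); apply: quotm_reprK.
move=> a x y; have [u <-] := pi_surj _ x; have [v <-] := pi_surj _ y.
by rewrite -bimod_hom_linear !adic_stepE bimod_hom_linear.
Qed.

Definition adic_tower : tower (symBimod A) :=
  Tower (tower_obj := adic_quot) (fun p => sym_hom (@adic_step_linear p)).

Definition adic_completion : symBimod A :=
  tower_lim (@symBimod_complete A) adic_tower.

Definition adic_proj (p : nat) : hom adic_completion (adic_quot p) :=
  tower_proj (@symBimod_complete A) adic_tower p.

End AdicCompletion.

(* Main.v *)
From HB Require Import structures.
Require Import Defs.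
From mathcomp Require Import all_boot ssralg.

Set Implicit Arguments.
Unset Strict Implicit.
Unset Printing Implicit Defensive.

Import GRing.Theory.
Local Open Scope cat_scope.
Local Open Scope ring_scope.

(** Everything rests on one computation: for a module H over A, the kernel of
    the unit H -> f_* f^* H is I H (adj_unit_eq0). It contains I H because
    f_* f^* H is restricted from A / I, hence killed by I. Conversely, H / I H
    is killed by I, so it is itself the restriction of a module over A / I, and
    by adjunction the projection H -> H / I H factors through the unit: what the
    unit kills lies in I H. The functor f^* enters only through this
    factorization, so its values are never described as tensor products.

    By induction, G^(p+1) = I G^p is the submodule I^(p+1) G of G
    (filt_incl_image), so that G_p = G / G^(p+1) is isomorphic, under G, to
    G / I^(p+1) G. The tower (G_p) is therefore the I-adic tower with its bottom
    term G / I^0 G = 0 removed, and dropping the bottom of a tower does not change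
    its limit (shifted_tower_iso). *)

(** * Limits of towers and uniqueness of cokernels *)

Section TowerShift.
Variable C : category.

Lemma tower_coneP (T : tower C) (L : C) (l : forall n, hom L (T n)) :
  is_cone (tower_map T) l <-> forall n, tower_step T n \c l n.+1 = l n.
Proof.
split=> [lP n|lP i j []]; last exact: lP.
exact: (lP _ _ (SuccEdge n)).
Qed.

Lemma limit_hom_eq (V : Type) (E : V -> V -> Type) (D : V -> C)
    (d : forall i j, E i j -> hom (D i) (D j)) L (l : forall i, hom L (D i)) :
  is_limit d l -> forall Z (u v : hom Z L),
  (forall i, l i \c u = l i \c v) -> u = v.
Proof.
move=> [lC lP] Z u v uv.
have [|w [_ wP]] := lP Z (fun i => l i \c v).
  by move=> i j e; rewrite Defs.compA lC.
by rewrite -(wP u) // -(wP v).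
Qed.

(** The cone over T' induced by L misses the component at 0; it has to be the
    composite of the component at 1 with the transition map. *)
Lemma shifted_tower_iso (T T' : tower C) L L'
    (l : forall n, hom L (T n)) (l' : forall n, hom L' (T' n))
    (psi : forall n, hom (T n) (T' n.+1)) :
  is_limit (tower_map T) l -> is_limit (tower_map T') l' ->
  (forall n, is_iso (psi n)) ->
  (forall n, tower_step T' n.+1 \c psi n.+1 = psi n \c tower_step T n) ->
  exists2 phi : hom L L', is_iso phi & forall n, l' n.+1 \c phi = psi n \c l n.
Proof.
move=> lL lL' psi_iso psiN.
pose xi n := projT1 (boolp.cid (psi_iso n)).
have xiP n : xi n \c psi n = idm _ /\ psi n \c xi n = idm _.
  exact: projT2 (boolp.cid (psi_iso n)).
have xiK n : xi n \c psi n = idm _ by case: (xiP n).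
have psiK n : psi n \c xi n = idm _ by case: (xiP n).
have lC := (tower_coneP l).1 lL.1; have l'C := (tower_coneP l').1 lL'.1.
have xiN n : tower_step T n \c xi n.+1 = xi n \c tower_step T' n.+1.
  rewrite -[LHS]comp1m -(xiK n) -(Defs.compA (xi n)) (Defs.compA (psi n)) -psiN.
  by rewrite -(Defs.compA _ (psi n.+1)) psiK compm1.
pose g n : hom L (T' n) :=
  if n is m.+1 then psi m \c l m else tower_step T' 0 \c (psi 0 \c l 0).
have [|phi [phiP _]] := lL'.2 L g.
  by apply/tower_coneP => -[|n] //=; rewrite Defs.compA psiN -Defs.compA lC.
have [|theta [thetaP _]] := lL.2 L' (fun n => xi n \c l' n.+1).
  by apply/tower_coneP => n; rewrite Defs.compA xiN -Defs.compA l'C.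
exists phi => [|n]; last exact: phiP n.+1.
exists theta; split.
  apply: (limit_hom_eq lL) => n.
  by rewrite Defs.compA thetaP -Defs.compA phiP /= Defs.compA xiK comp1m compm1.
have phithetaS n : l' n.+1 \c (phi \c theta) = l' n.+1.
  by rewrite Defs.compA phiP /= -Defs.compA thetaP Defs.compA psiK comp1m.
apply: (limit_hom_eq lL') => -[|n]; rewrite compm1 ?phithetaS //.
by rewrite -l'C -Defs.compA phithetaS.
Qed.

Lemma cokernel_epic (X Y Q : C) (f : hom X Y) (q : hom Y Q) :
  is_cokernel f q -> epic q.
Proof.
move=> [[O [a [b [O0 qf]]]] qP] Z g h gh.
have [|u [_ uP]] := qP Z (h \c q); last by rewrite -(uP g) // -(uP h).
by exists O, (h \c a), b; split; rewrite // -Defs.compA qf Defs.compA.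
Qed.

Lemma cokernel_iso (X Y Q Q' : C) (f : hom X Y) (q : hom Y Q) (q' : hom Y Q') :
  is_cokernel f q -> is_cokernel f q' ->
  exists2 psi : hom Q Q', is_iso psi & psi \c q = q'.
Proof.
move=> qP q'P; have [u [uq _]] := qP.2 _ _ q'P.1.
have [v [vq' _]] := q'P.2 _ _ qP.1.
exists u => //; exists v; split.
  by apply: (cokernel_epic qP); rewrite -Defs.compA uq vq' comp1m.
by apply: (cokernel_epic q'P); rewrite -Defs.compA vq' uq comp1m.
Qed.

End TowerShift.

(** * Products with ideals, images and kernels *)

Section IdealProductTheory.
Variable A : comPzRingType.
Implicit Types (V : lmodType A) (J K : ideal A).

Lemma smemD V (S : submodule V) u v : S u -> S v -> S (u + v).
Proof. by move=> Su Sv; rewrite -[u]scale1r; apply: smem_lin. Qed.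

Lemma quotm_pi_eq0 V (S : submodule V) v : quotm_pi S v = 0 <-> S v.
Proof.
have <- : quotm_pi S 0 = 0.
  by apply: (addrI (quotm_pi S 0)); rewrite -quotm_piD !addr0.
by rewrite quotm_piP subr0.
Qed.

Lemma iprod_gen V J (N : submodule V) a v : J a -> N v -> iprod J N (a *: v).
Proof.
move=> Ja Nv; exists [:: (a, v)]; last by rewrite big_seq1.
by move=> x; rewrite inE => /eqP ->.
Qed.

Lemma iprod_elim V J (N : submodule V) (P : V -> Prop) :
  P 0 -> (forall u v, P u -> P v -> P (u + v)) ->
  (forall a v, J a -> N v -> P (a *: v)) -> forall v, iprod J N v -> P v.
Proof.
move=> P0 PD Pgen _ [s sP ->]; elim: s sP => [|x s IH] sP.
  by rewrite big_nil.
rewrite big_cons; apply: PD.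
  by have [Jx Nx] := sP x (mem_head _ _); apply: Pgen.
by apply: IH => y ys; apply: sP; rewrite inE ys orbT.
Qed.

Lemma iprodA V J K (N : submodule V) v :
  iprod J (iprod K N) v <-> iprod (iprod J K) N v.
Proof.
split; move: v; apply: iprod_elim; try exact: smem0; try exact: smemD.
  move=> a v Ja; move: v; apply: iprod_elim => [|u v|b v Kb Nv].
  - by rewrite scaler0; apply: smem0.
  - by rewrite scalerDr; apply: smemD.
  - by rewrite scalerA; apply: iprod_gen => //; apply: (@iprod_gen A^o).
move=> c v + Nv; move: c; apply: iprod_elim => [|a b|a b Ja Kb].
- by rewrite scale0r; apply: smem0.
- by rewrite scalerDl; apply: smemD.
- by rewrite -scalerA; do 2!apply: iprod_gen => //.
Qed.

Lemma iprod_full1 V v : iprod (full_submodule A^o) (full_submodule V) v.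
Proof. by rewrite -[v]scale1r; apply: iprod_gen. Qed.

Lemma iprod_image (M N : symBimod_cat A) (h : hom M N) J (S : submodule N) :
  (forall v, S v <-> exists u, h u = v) -> forall v,
  iprod J S v <-> exists2 u, iprod J (full_submodule M) u & h u = v.
Proof.
move=> SP v; have hZ a u : h (a *: u) = a *: h u.
  by rewrite -[a *: u]addr0 bimod_hom_linear bimod_hom0 addr0.
have hD u w : h (u + w) = h u + h w.
  by rewrite -[u]scale1r bimod_hom_linear !scale1r.
split; last first.
  move=> [u uP <-]; move: u uP; apply: iprod_elim => [|u w|a u Ja _].
  - by rewrite bimod_hom0; apply: smem0.
  - by rewrite hD; apply: smemD.
  - by rewrite hZ; apply: iprod_gen => //; apply/SP; exists u.
move: v; apply: iprod_elim => [|_ _ [u uP <-] [w wP <-]|a _ Ja /SP[u <-]].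
- by exists 0; [exact: smem0|exact: bimod_hom0].
- by exists (u + w); [exact: smemD|exact: hD].
- by exists (a *: u); [exact: iprod_gen|exact: hZ].
Qed.

(** The inclusion of the submodule of elements that f kills factors through any
    kernel of f, so the kernels picked by choice have the expected image. *)
Lemma kernel_image (M N P : symBimod_cat A) (f : hom M N) (k : hom P M) :
  is_kernel f k -> forall v, f v = 0 <-> exists u, k u = v.
Proof.
move=> [/is_zero_bimod_hom fk kP] v; split=> [fv|[u <-]]; last exact: fk.
have [|w [kw _]] := kP _ (ker_incl f).
  by apply/is_zero_bimod_hom => u; apply: ker_inclP.
have [u <-] := ker_incl_surj fv; exists (w u).
by rewrite -kw.
Qed.

End IdealProductTheory.

(** * Modules over A / I as modules killed by I *)

Section KilledModule.
Variables (A : comPzRingType) (I : ideal A) (M : lmodType A).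
Hypothesis M_killed : forall a (v : M), I a -> a *: v = 0.

(** An alias of M, parameterized by the proof that I kills M so that the action
    of A / I can be attached to it. *)
Definition killed_module of (forall a (v : M), I a -> a *: v = 0) : Type := M.
Local Notation N := (killed_module M_killed).
HB.instance Definition _ := GRing.Zmodule.on N.

Definition killed_scale (x : quotr I) (v : N) : N := (repr x : A) *: (v : M).

Lemma killed_scaleE (a : A) (v : N) :
  killed_scale (quotr_pi I a) v = a *: (v : M).
Proof.
apply/eqP; rewrite -subr_eq0 -scalerBl; apply/eqP/M_killed.
exact/(quotm_piP I)/quotm_reprK.
Qed.

Fact killed_scaleA x y v :
  killed_scale x (killed_scale y v) = killed_scale (x * y) v.
Proof.
rewrite -[x]quotr_reprK -[y]quotr_reprK -rmorphM !killed_scaleE.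
exact: scalerA.
Qed.
Fact killed_scale1 : left_id 1 killed_scale.
Proof. by move=> v; rewrite -(rmorph1 (quotr_pi I)) killed_scaleE scale1r. Qed.
Fact killed_scaleDr : right_distributive killed_scale +%R.
Proof. by move=> x u v; apply: scalerDr. Qed.
Fact killed_scaleDl v : {morph killed_scale^~ v : x y / x + y}.
Proof.
move=> x y; rewrite -[x]quotr_reprK -[y]quotr_reprK -rmorphD !killed_scaleE.
exact: scalerDl.
Qed.

HB.instance Definition _ := GRing.Zmodule_isLmodule.Build (quotr I) N
  killed_scaleA killed_scale1 killed_scaleDr killed_scaleDl.

Definition killed_bimod : symBimod (quotr I) := sym_of_lmod N.

Lemma killed_restr_linear :
  linear (fun v : M => v : restriction_of_scalars (quotr_pi I) killed_bimod).
Proof. by move=> a u v; congr (_ + _); rewrite -killed_scaleE. Qed.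

Definition killed_restr :
    hom (sym_of_lmod M : symBimod A)
      (restriction_of_scalars (quotr_pi I) killed_bimod) :=
  sym_hom (M := sym_of_lmod M) killed_restr_linear.

End KilledModule.

(** * The unit of the adjunction and the filtration *)

Section Unit.
Variables (A : comPzRingType) (I : ideal A).
Variable L : functor (symBimod A) (symBimod (quotr I)).
Variable adj : adjunction L (restriction_of_scalars (quotr_pi I)).

Lemma quotm_iprod_killed (V : lmodType A) a
    (x : quotm (iprod I (full_submodule V))) : I a -> a *: x = 0.
Proof.
move=> Ia; rewrite -[x]quotm_reprK -[LHS]/(quotm_scale _ _) quotm_scaleE.
exact/quotm_pi_eq0/iprod_gen.
Qed.

(** The factorization q = r o eta of the projection q : H -> H / I H through
    the unit is the transpose of q under the adjunction, written out with the
    counit. *)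
Lemma adj_unit_eq0 (H : symBimod_cat A) (v : H) :
  adj_unit adj H v = 0 <-> iprod I (full_submodule H) v.
Proof.
split=> [eta_v|]; last first.
  move: v; apply: iprod_elim => [|u v eta_u eta_v|a v Ia _].
  - exact: bimod_hom0.
  - by rewrite -[u]scale1r bimod_hom_linear eta_u eta_v addr0 scaler0.
  - rewrite -[a *: v]addr0 bimod_hom_linear bimod_hom0 addr0.
    (* On a restricted module, a acts through its class in A / I. *)
    have a0 : quotr_pi I a = 0 by apply/(quotm_pi_eq0 I).
    rewrite -[LHS]/(quotr_pi I a *: (adj_unit adj H v : L H)) a0.
    exact: (scale0r (adj_unit adj H v : (L H : symBimodule (quotr I)))).
pose S := iprod I (full_submodule H).
pose N := killed_bimod (@quotm_iprod_killed H).
pose q : hom H (restriction_of_scalars (quotr_pi I) N) :=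
  killed_restr (@quotm_iprod_killed H) \c
  sym_hom (N := sym_of_lmod (quotm S)) (quotm_pi_linear S).
pose r := fmap (restriction_of_scalars (quotr_pi I))
  (adj_counit adj N \c fmap L q).
have qE : q = r \c adj_unit adj H.
  by rewrite /r fmapM -Defs.compA adj_unit_nat Defs.compA adj_triangleR comp1m.
apply/quotm_pi_eq0; rewrite -[LHS]/(q v) qE.
exact: etrans (congr1 r eta_v) (bimod_hom0 r).
Qed.

End Unit.

Section Filtration.
Variables (A : comPzRingType) (I : ideal A).
Variable f : morphism (symBimod (quotr I)) (symBimod A).
Hypothesis f_restr : direct_image f = restriction_of_scalars (quotr_pi I).
Variable G : symBimod A.

Lemma unit_at_eq0 (H : symBimod_cat A) (v : H) :
  unit_at f H v = 0 <-> iprod I (full_submodule H) v.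
Proof.
rewrite /unit_at; move: f_restr; case: f => L R adj /= RE.
by subst R; exact: adj_unit_eq0.
Qed.

(** The kernel of the unit at G^p is I G^p by adj_unit_eq0, and an image commutes
    with multiplication by I, so the image of G^(p+1) in G is I (I^p G). *)
Lemma filt_incl_image p v :
  adic_subm I G p v <-> exists u, filt_incl f G p u = v.
Proof.
elim: p v => [|p IH] v.
  by split=> [_|_]; [exists v|exact: iprod_full1].
have kerE := kernel_image (kerP (unit_at f (filt f G p))).
rewrite /adic_subm -iprodA (iprod_image I IH); split.
  by move=> [u /unit_at_eq0/kerE[w <-] <-]; exists w.
move=> [w <-]; exists (filt_step f G p w) => //.
by apply/unit_at_eq0/kerE; exists w.
Qed.

Lemma adic_pi_cokernel p : is_cokernel (filt_incl f G p) (adic_pi I G p).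
Proof.
apply: surj_is_cokernel => [x|v].
  by exists (repr (x : quotm _)); apply: quotm_reprK.
by rewrite -filt_incl_image; apply: quotm_pi_eq0.
Qed.

End Filtration.

Local Close Scope ring_scope.

Theorem proposition9 (A : comPzRingType) (I : ideal A)
    (f : morphism (symBimod (quotr I)) (symBimod A))
    (f_restr : direct_image f = restriction_of_scalars (quotr_pi I))
    (G : symBimod A) :
  exists phi : hom (completion f G (@symBimod_complete A)) (adic_completion I G),
    is_iso phi /\
    forall p : nat,
      exists psi : hom (filt_quot f G p) (adic_quot I G p.+1),
        [/\ is_iso psi,
            psi \c coker (filt_incl f G p.+1) = adic_pi I G p.+1 &
            adic_proj I G p.+1 \c phi =
              psi \c completion_proj f G (@symBimod_complete A) p].
Proof.
pose c p := coker (filt_incl f G p.+1).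
have cP p : is_cokernel (filt_incl f G p.+1) (c p) by apply: cokerP.
have ex_psi p : exists psi : hom (filt_quot f G p) (adic_quot I G p.+1),
    is_iso psi /\ psi \c c p = adic_pi I G p.+1.
  have [psi] := cokernel_iso (cP p) (adic_pi_cokernel f_restr G p.+1).
  by exists psi.
pose psi p := projT1 (boolp.cid (ex_psi p)).
have psiP p : is_iso (psi p) /\ psi p \c c p = adic_pi I G p.+1.
  exact: projT2 (boolp.cid (ex_psi p)).
have [|p|phi phi_iso phiP] := shifted_tower_iso
  (T := filt_tower f G) (T' := adic_tower I G) (psi := psi)
  (tower_limP (@symBimod_complete A) (filt_tower f G))
  (tower_limP (@symBimod_complete A) (adic_tower I G)).
- by move=> p; case: (psiP p).
- apply: (cokernel_epic (cP p.+1)).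
  have cS : tower_step (filt_tower f G) p \c c p.+1 = c p.
    exact: (coker_mapE (filt_incl f G p.+1) (filt_step f G p.+1)).
  rewrite -Defs.compA (psiP p.+1).2 -Defs.compA cS (psiP p).2.
  by apply: bimod_homP => v; apply: adic_stepE.
exists phi; split=> [|p]; first exact: phi_iso.
have [psi_iso psi_c] := psiP p.
by exists (psi p); split; [exact: psi_iso|exact: psi_c|exact: phiP].
Qed.
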